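(* For any $\gamma>0$ and any $p\in\mathcal{P}_K$, the quadratic risk of the plug-in estimator $\hat F_\gamma$ satisfies $$\mathbb{E}_p\left[(\hat F_\gamma-F_\gamma)^2\right]\lesssim_\gamma \frac{K^2}{(\alpha^2 n)^{\gamma}}+\mathbf{1}_{\{\gamma\ge 2\}}\frac{\|p^{\ge\tau}\|_{\gamma-2}^{2(\gamma-2)}}{(\alpha^2 n)^2}+\mathbf{1}_{\{\gamma\ge 1\}}\frac{\|p^{\ge\tau}\|_{2\gamma-2}^{2\gamma-2}}{\alpha^2 n},$$ and thus is uniformly bounded over all $p\in\mathcal{P}_K$ by $$\sup_{p\in\mathcal{P}_K}\mathbb{E}\left[(\hat F_\gamma-F_\gamma)^2\right]\lesssim_\gamma \frac{K^2}{(\alpha^2 n)^{\gamma}}+\mathbf{1}_{\{\gamma\ge 1\}}\frac{(\tau^{-1}\wedge K)^{3-2\gamma}\vee 1}{\alpha^2 n}.$$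
   Context: $K,n$ are positive integers, $[K]=\{1,\dots,K\}$, and the privacy level $\alpha\in(0,1)$ satisfies $\alpha^2 n\ge 1$. $\mathcal{P}_K=\{p\in[0,1]^K:\sum_{k=1}^K p_k=1\}$, and $F_\gamma=F_\gamma(p)=\sum_{k=1}^K p_k^\gamma$. The sensitive data $x_1,\dots,x_n$ are i.i.d. with $\mathbb{P}(x_i=k)=p_k$, $k\in[K]$. The Laplace non-interactive privacy mechanism releases $z_i=(z_{i1},\dots,z_{iK})$ with $z_{ik}=\mathbf{1}_{\{x_i=k\}}+\frac{\sigma}{\alpha}w_{ik}$, where $\sigma=2$ and the $w_{ik}$ are i.i.d. with density $\frac12 e^{-|x|}$ on $\mathbb{R}$, independent of the $x_i$. Let $\hat z_k=\frac1n\sum_{i=1}^n z_{ik}$ and let $T_{[0,2]}[y]=(y\vee 0)\wedge 2$. The plug-in estimator is $\hat F_\gamma=\sum_{k=1}^K\hat F_\gamma(k)$ with $\hat F_\gamma(k)=(T_{[0,2]}[\hat z_k])^\gamma$. $\tau=c/\sqrt{\alpha^2 n}$ where $c\ge 1$ is a fixed numerical constant. $p^{\ge\tau}$ is the vector with coordinates $p_k\mathbf{1}(p_k\ge\tau)$, and for real $r$ one writes $\|p^{\ge\tau}\|_r^r=\sum_{k:\,p_k\ge\tau}p_k^r$ (so $\|p^{\ge\tau}\|_{\gamma-2}^{2(\gamma-2)}=(\sum_{k:\,p_k\ge\tau}p_k^{\gamma-2})^2$). $\mathbf{1}$ denotes an indicator, $x\wedge y=\min\{x,y\}$, $x\vee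 y=\max\{x,y\}$. The relation $x\lesssim_\gamma y$ means $x\le C_\gamma y$ for some constant $C_\gamma$ depending only on $\gamma$. *)

(* Defs.v *)
From mathcomp Require Import all_boot all_order all_algebra.
From mathcomp Require Import all_classical all_reals all_analysis.
Set Implicit Arguments.
Unset Strict Implicit.
Unset Printing Implicit Defensive.
Import Order.TTheory GRing.Theory Num.Theory.
Import numFieldNormedType.Exports.
Local Open Scope classical_set_scope.
Local Open Scope ring_scope.

Definition simplex (R : realType) (K : nat) : set ('I_K -> R) :=
  [set p | (forall k, 0 <= p k <= 1) /\ \sum_(k < K) p k = 1].

Definition power_sum (R : realType) (K : nat) (gamma : R) (p : 'I_K -> R) : R :=
  \sum_(k < K) p k `^ gamma.

(* [||p^{>= tau}||_r^r]; for [0 < tau] the coordinates that are kept are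
   positive, so [`^] is the usual real power for every sign of [r]. *)
Definition power_sum_above (R : realType) (K : nat) (tau r : R)
    (p : 'I_K -> R) : R :=
  \sum_(k < K | tau <= p k) p k `^ r.

Definition mutually_independent d (T : measurableType d) (R : realType)
    (P : probability T R) (I : finType) (F : I -> set_system T) : Prop :=
  forall (J : {set I}) (E : I -> set T), (forall i, i \in J -> F i (E i)) ->
    P (\bigcap_(i in [set` J]) E i) = (\prod_(i in J) P (E i))%E.

Definition laplace_density (R : realType) (y : R) : R := expR (- `|y|) / 2.

Section LaplaceMechanism.
Context d (T : measurableType d) (R : realType) (n K : nat).
Variables (x : 'I_n -> T -> 'I_K) (w : 'I_n -> 'I_K -> T -> R).

(* The sigma-algebras generated by the individual [x i] and [w i k]. *)
Definition generated_by (v : 'I_n + 'I_n * 'I_K) : set_system T :=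
  match v with
  | inl i => preimage_set_system setT (x i) setT
  | inr ik => preimage_set_system setT (w ik.1 ik.2) measurable
  end.

(* Independence of the whole family says at once that the [x i] are
   independent, that the [w i k] are independent, and that the two families are
   independent of each other. *)
Record laplace_model (p : 'I_K -> R) (P : probability T R) : Prop := {
  data_measurable : forall i k, measurable (x i @^-1` [set k]) ;
  noise_measurable : forall i k, measurable_fun setT (w i k) ;
  data_law : forall i k, P (x i @^-1` [set k]) = (p k)%:E ;
  noise_law : forall i k (B : set R), measurable B ->
    P (w i k @^-1` B)
      = (\int[lebesgue_measure]_(y in B) (laplace_density y)%:E)%E ;
  data_noise_independent : mutually_independent P generated_by }.

Definition privatized (sigma alpha : R) (i : 'I_n) (k : 'I_K) (t : T) : R :=
  (x i t == k)%:R + sigma / alpha * w i k t.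

Definition privatized_mean (sigma alpha : R) (k : 'I_K) (t : T) : R :=
  n%:R^-1 * \sum_(i < n) privatized sigma alpha i k t.

Definition truncate02 (y : R) : R := Num.min (Num.max y 0) 2.

Definition plug_in (alpha gamma : R) (t : T) : R :=
  \sum_(k < K) truncate02 (privatized_mean 2 alpha k t) `^ gamma.

Definition quadratic_risk (alpha gamma : R) (p : 'I_K -> R)
    (P : probability T R) : \bar R :=
  'E_P[fun t => ((plug_in alpha gamma t - power_sum gamma p) ^+ 2)%R]%E.

End LaplaceMechanism.

(* Main.v *)
Require Import Defs.
From mathcomp Require Import all_boot all_order all_algebra.
From mathcomp Require Import all_classical all_reals all_analysis.
From mathcomp Require Import measurable_realfun ring lra.
Import Order.TTheory GRing.Theory Num.Theory.
Import numFieldNormedType.Exports.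
Local Open Scope classical_set_scope.
Local Open Scope ring_scope.

(* Idea: for weights a with sum a_k^2 <= A, the centred statistic
   S = sum_k a_k (zhat_k - p_k) is an average of independent variables with
   explicit exponential moments, and E exp(theta S) <= e as soon as
   16 A theta^2 = alpha^2 n. Hence E|S|^r <~ (A / (alpha^2 n))^(r/2) for every
   r > 0. This controls each coordinate error (a an indicator) and the linear
   part of the risk (a_k = p_k^(gamma-1)) without any covariance computation.

   Pointwise, the truncation T satisfies
     |T(z)^gamma - v^gamma - 1{gamma >= 1} gamma v^(gamma-1) (z - v)|
       <~ |z - v|^gamma + 1{gamma >= 2} v^(gamma-2) (z - v)^2
   with the untruncated z in the linear term, because z is truncated only when
   v <= |z - v|. Squaring, Cauchy-Schwarz and the moment bounds give the risk
   bound with full sums of p_k^r; the coordinates below tau contribute at most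
   K tau^r. The uniform bound follows since at most min(1/tau, K) coordinates
   exceed tau. *)

(** * Integrals that depend only on a weighted image measure *)

Section transfer.
Import HBNNSimple.
Local Open Scope ereal_scope.

(** In this finite sum [phi] and [g] enter only through the [g]-weighted masses of preimages under
    [phi], which is the data that [integral_comp_mul_eq] assumes equal on the two sides. *)
Lemma integral_nnsfun_comp_mul {d} {T : measurableType d} {dS} {S : measurableType dS}
    {R : realType} (mu : {measure set T -> \bar R}) (phi : T -> S) (g : T -> R)
    (h : {nnsfun S >-> R}) :
  measurable_fun setT phi -> measurable_fun setT g -> (forall t, 0 <= g t)%R ->
  \int[mu]_t (h (phi t) * g t)%:E =
  \sum_(r \in range h) r%:E * \int[mu]_(t in phi @^-1` (h @^-1` [set r])) (g t)%:E.
Proof.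
move=> mphi mg g0.
have mhp r : measurable (phi @^-1` (h @^-1` [set r])).
  by rewrite -(setTI (phi @^-1` _)); apply: mphi.
transitivity (\int[mu]_t \sum_(r \in range h)
   (r * \1_(phi @^-1` (h @^-1` [set r])) t)%:E * (g t)%:E).
  apply: eq_integral => t _.
  rewrite -ge0_mule_fsuml => [|r]; last first.
    exact: (nnfun_muleindic_ge0 h r (phi t)).
  by rewrite fsumEFin// EFinM {1}(fimfunE h).
rewrite ge0_integral_fsum//; last 2 first.
- move=> r; apply: emeasurable_funM; apply/measurable_EFinP => //.
  by apply: measurable_funM => //; exact: measurable_indic.
- move=> r t _; rewrite mule_ge0 ?lee_fin//.
  exact: (nnfun_muleindic_ge0 h r (phi t)).
apply: eq_fsbigr => r /[!inE] -[s _ rs].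
transitivity (\int[mu]_t (r%:E * ((g t)%:E * (\1_(phi @^-1` (h @^-1` [set r])) t)%:E))).
  by apply: eq_integral => t _; rewrite EFinM -muleA [X in _ * X = _]muleC.
rewrite ge0_integralZl//.
- rewrite [in RHS]integral_mkcond; congr (_ * _); apply: eq_integral => t _.
  by rewrite epatch_indic.
- by apply: emeasurable_funM; exact/measurable_EFinP.
- by move=> t _; rewrite mule_ge0 ?lee_fin.
- by rewrite lee_fin -rs.
Qed.

(** Simple functions are handled by the preceding formula, and monotone convergence along
    [nnsfun_approx] gives the rest. It serves twice: to replace a product of factors by a constant
    under independence, and to pass from [P] to the Laplace density. *)
Lemma integral_comp_mul_eq {d1} {T1 : measurableType d1} {d2} {T2 : measurableType d2}
    {dS} {S : measurableType dS} {R : realType}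
    (mu1 : {measure set T1 -> \bar R}) (mu2 : {measure set T2 -> \bar R})
    (phi1 : T1 -> S) (phi2 : T2 -> S) (g1 : T1 -> R) (g2 : T2 -> R) (h : S -> R) :
  measurable_fun setT phi1 -> measurable_fun setT g1 -> (forall t, 0 <= g1 t)%R ->
  measurable_fun setT phi2 -> measurable_fun setT g2 -> (forall t, 0 <= g2 t)%R ->
  measurable_fun setT h -> (forall s, 0 <= h s)%R ->
  (forall B, measurable B -> \int[mu1]_(t in phi1 @^-1` B) (g1 t)%:E =
                             \int[mu2]_(t in phi2 @^-1` B) (g2 t)%:E) ->
  \int[mu1]_t (h (phi1 t) * g1 t)%:E = \int[mu2]_t (h (phi2 t) * g2 t)%:E.
Proof.
move=> mphi1 mg1 g10 mphi2 mg2 g20 mh h0 eqB.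
have mEh : measurable_fun setT (EFin \o h) by exact/measurable_EFinP.
have Eh0 s : setT s -> 0 <= (EFin \o h) s by move=> _; rewrite lee_fin.
pose H := nnsfun_approx measurableT mEh.
have lim d (T : measurableType d) (mu : {measure set T -> \bar R}) (phi : T -> S)
    (g : T -> R) : measurable_fun setT phi -> measurable_fun setT g ->
    (forall t, 0 <= g t)%R ->
    \int[mu]_t (h (phi t) * g t)%:E = limn (fun n => \int[mu]_t (H n (phi t) * g t)%:E).
  move=> mphi mg g0.
  rewrite -monotone_convergence//.
  - apply: eq_integral => t _; apply/esym/cvg_lim => //.
    rewrite EFinM; under eq_fun do rewrite EFinM.
    by apply: cvgeZr => //; exact: (cvg_nnsfun_approx measurableT mEh Eh0).
  - move=> n; apply/measurable_EFinP; apply: measurable_funM => //.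
    exact: measurableT_comp.
  - by move=> n t _; rewrite lee_fin mulr_ge0.
  - move=> t _ m n mn; rewrite lee_fin ler_wpM2r//.
    exact/lefP/nd_nnsfun_approx.
rewrite !lim//; congr (limn _); apply/funext => n.
rewrite !integral_nnsfun_comp_mul//; apply: eq_fsbigr => r _.
by rewrite eqB.
Qed.

End transfer.

(** * Expectation of a product of independent nonnegative functions *)

Section independence.
Local Open Scope ereal_scope.
Context {d} {T : measurableType d} {R : realType} (P : probability T R).
Context {I : finType} (F : I -> set_system T).
Hypothesis indepF : mutually_independent P F.
Hypothesis measF : forall i, F i `<=` measurable.

Lemma prod_indic (E : I -> set T) (t : T) :
  (\prod_i \1_(E i) t = \1_(\bigcap_i E i) t :> R)%R.
Proof.
rewrite [RHS]indicE; case: (boolP (t \in \bigcap_i E i)) => [/set_mem tE|].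
  by rewrite big1// => i _; rewrite indicE mem_set//; exact: tE.
apply: contraNeq => /prodf_neq0 tE; apply/mem_set => i _.
move: (tE i isT); rewrite indicE; case: (boolP (t \in E i)) => [/set_mem//|].
by rewrite eqxx.
Qed.

(* Independence is stated for events, so the functions are replaced by
   indicators one index at a time; [s] lists the indices still to be replaced. *)
Lemma independent_expectation_prod_seq (s : seq I) (f : I -> T -> R) :
  uniq s ->
  (forall i, i \in s -> forall B, measurable B -> F i (f i @^-1` B)) ->
  (forall i, i \in s -> forall t, 0 <= f i t)%R ->
  (forall i, i \notin s -> exists2 E, F i E & f i = \1_E) ->
  (forall i, i \in s -> \int[P]_t (f i t)%:E < +oo) ->
  \int[P]_t (\prod_i f i t)%:E = \prod_i \int[P]_t (f i t)%:E.
Proof.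
elim: s f => [|a s IH] f.
  move=> _ _ _ fE _.
  have /choice[E FE] : forall i, exists E, F i E /\ f i = \1_E.
    by move=> i; have [//|E] := fE i; exists E.
  under eq_integral => t _.
    under eq_bigr => i _ do rewrite (FE i).2.
    rewrite prod_indic.
    over.
  have mE : measurable (\bigcap_i E i).
    by apply: fin_bigcap_measurable => // i _; apply: measF (FE i).1.
  rewrite integral_indic// setIT.
  have := indepF (finset.setTfor I) E (fun i _ => (FE i).1).
  rewrite (_ : \bigcap_(i in [set` (finset.setTfor I)]) E i = \bigcap_i E i); last first.
    by apply: eq_bigcapl; split => i //= _; rewrite inE.
  move=> indepE; transitivity (P (\bigcap_i E i)) => //; rewrite {}indepE.
  apply: eq_big => [i|i _]; first by rewrite inE.
  rewrite (FE i).2 integral_indic// ?setIT//.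
  exact: measF (FE i).1.
move=> /= /andP[aNs us] Ff f0 fE ffin.
have mf i : measurable_fun setT (f i).
  have [ias|/fE[E FE ->]] := boolP (i \in a :: s).
    by move=> _ B mB; rewrite setTI; apply: measF; exact: Ff.
  by apply: measurable_indic; exact: measF FE.
have f0' i t : (0 <= f i t)%R.
  have [ias|/fE[E FE ->]] := boolP (i \in a :: s); first exact: f0.
  by rewrite indicE.
have ffin' i : \int[P]_t (f i t)%:E < +oo.
  have [ias|/fE[E FE ->]] := boolP (i \in a :: s); first exact: ffin.
  rewrite integral_indic ?setIT//; last exact: measF FE.
  by rewrite (le_lt_trans (probability_le1 _ (measF _ _ FE)))// ltry.
pose c := (\prod_(i | i != a) fine (\int[P]_t (f i t)%:E))%R.
have cE : \prod_(i | i != a) \int[P]_t (f i t)%:E = c%:E.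
  rewrite /c -prodEFin; apply: eq_bigr => i _; rewrite fineK//.
  by rewrite ge0_fin_numE//; apply: integral_ge0 => t _; rewrite lee_fin.
have c0 : (0 <= c)%R.
  by apply: prodr_ge0 => i _; apply/fine_ge0/integral_ge0 => t _; rewrite lee_fin.
pose g t := (\prod_(i | i != a) f i t)%R.
have mg : measurable_fun setT g.
  rewrite /g; under eq_fun do rewrite -big_filter.
  by apply: measurable_prod => i _.
have g0 t : (0 <= g t)%R by exact: prodr_ge0.
have gB B : measurable B -> \int[P]_(t in f a @^-1` B) (g t)%:E =
    \int[P]_(t in f a @^-1` B) (cst c t)%:E.
  move=> mB; have FB : F a (f a @^-1` B) by apply: Ff => //; rewrite mem_head.
  have mfB := measF _ _ FB.
  pose f' i := if i == a then \1_(f a @^-1` B) else f i.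
  have f'E i : i != a -> f' i = f i by rewrite /f' => /negbTE->.
  have f'a : f' a = \1_(f a @^-1` B) by rewrite /f' eqxx.
  have saE i : i \in s -> i != a by apply: contraTneq => ->.
  have intB : \int[P]_t (f' a t)%:E = P (f a @^-1` B).
    by rewrite f'a integral_indic// setIT.
  transitivity (\int[P]_t (\prod_i f' i t)%:E).
    rewrite integral_mkcond; apply: eq_integral => t _.
    rewrite epatch_indic (bigD1 a)//= f'a mulrC EFinM; congr (_ * _).
    by congr EFin; apply: eq_bigr => i /f'E ->.
  rewrite IH//.
  - rewrite (bigD1 a)//= intB.
    under eq_bigr => i /f'E -> do over.
    by rewrite cE integral_cst// muleC.
  - by move=> i si; rewrite (f'E _ (saE _ si)); apply: Ff; rewrite inE si orbT.
  - by move=> i si t; rewrite (f'E _ (saE _ si)).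
  - move=> i si; have [->|ia] := eqVneq i a; first by exists (f a @^-1` B).
    by rewrite f'E//; apply: fE; rewrite inE negb_or ia.
  - by move=> i si; rewrite (f'E _ (saE _ si)).
rewrite (bigD1 a)//= cE.
(* The absolute value is inserted because the transfer needs an outer function that is nonnegative
   on all of [R]; on the range of [f a] it changes nothing. *)
transitivity (\int[P]_t (`|f a t| * g t)%:E).
  by apply: eq_integral => t _; rewrite ger0_norm// (bigD1 a).
rewrite (@integral_comp_mul_eq _ _ _ _ _ _ R P P (f a) (f a) g (cst c) Num.norm)//.
rewrite [RHS]muleC -ge0_integralZl//.
- by apply: eq_integral => t _; rewrite /= ger0_norm// EFinM muleC.
- exact/measurable_EFinP.
- by move=> t _; rewrite lee_fin.
Qed.

Lemma independent_expectation_prod (f : I -> T -> R) :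
  (forall i B, measurable B -> F i (f i @^-1` B)) ->
  (forall i t, 0 <= f i t)%R ->
  (forall i, \int[P]_t (f i t)%:E < +oo) ->
  \int[P]_t (\prod_i f i t)%:E = \prod_i \int[P]_t (f i t)%:E.
Proof.
move=> Ff f0 ffin; apply: (@independent_expectation_prod_seq (enum I)) => //.
- exact: enum_uniq.
- by move=> i _; exact: Ff.
- by move=> i; rewrite mem_enum.
Qed.

End independence.

(** * The Laplace moment generating function and elementary exponential bounds *)

Lemma integral_expR_half_line {R : realType} (r : R) : 0 < r ->
  (\int[lebesgue_measure]_(y in `[0%R, +oo[) (expR (- r * y))%:E = (r^-1)%:E)%E.
Proof.
move=> r0.
have mexp : measurable_fun setT (fun y => expR (- r * y)).
  by apply: measurableT_comp => //; exact: measurable_funM.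
transitivity (r^-1%:E * \int[lebesgue_measure]_(y in `[0%R, +oo[) (r * expR (- r * y))%:E)%E.
  rewrite -ge0_integralZl//; last 3 first.
  - apply: measurable_funTS; apply/measurable_EFinP.
    exact: measurable_funM.
  - by move=> y _; rewrite lee_fin mulr_ge0 ?expR_ge0// ltW.
  - by rewrite lee_fin invr_ge0 ltW.
  by apply: eq_integral => y _; rewrite -EFinM mulKf// gt_eqF.
rewrite -[RHS]mule1 -(integral_exponential_pdf r0) integral_mkcond.
congr (_ * _)%E; apply: eq_integral => y _.
by rewrite /exponential_pdf /patch; case: ifP.
Qed.

Lemma measurable_laplace_density {R : realType} :
  measurable_fun setT (@laplace_density R).
Proof.
apply: measurable_funM => //; apply: measurableT_comp => //.
by apply: measurableT_comp => //; exact: normr_measurable.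
Qed.

Lemma laplace_density_ge0 {R : realType} (y : R) : 0 <= laplace_density y.
Proof. by rewrite divr_ge0// expR_ge0. Qed.

(** Cutting the line at 0 and reflecting the left half leaves two exponential integrals, and 1/2
    (1/(1-s) + 1/(1+s)) = 1/(1-s^2). *)
Lemma laplace_mgf {R : realType} (s : R) : `|s| < 1 ->
  (\int[lebesgue_measure]_y (expR (s * y) * laplace_density y)%:E
   = ((1 - s ^+ 2)^-1)%:E)%E.
Proof.
move=> s1; have [sN1 s1'] : - 1 < s /\ s < 1 by move: s1; rewrite ltr_norml => /andP[].
pose f y : \bar R := (expR (s * y) * laplace_density y)%:E.
have mf : measurable_fun setT f.
  apply/measurable_EFinP; apply: measurable_funM; last exact: measurable_laplace_density.
  by apply: measurableT_comp => //; exact: measurable_funM.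
have f0 y : (0 <= f y)%E by rewrite lee_fin mulr_ge0 ?expR_ge0 ?laplace_density_ge0.
have half (q : R) : -1 < q -> q < 1 -> (\int[lebesgue_measure]_(y in `[0%R, +oo[)
    (expR (q * y) * laplace_density y)%:E = (2^-1 * (1 - q)^-1)%:E)%E.
  move=> qN1 q1; rewrite EFinM -(@integral_expR_half_line _ (1 - q)) ?subr_gt0//.
  rewrite -ge0_integralZl//.
  - apply: eq_integral => y; rewrite inE/= in_itv/= andbT => y0.
    rewrite /laplace_density ger0_norm// mulrA -expRD -EFinM mulrC.
    by congr (_ * expR _)%:E; ring.
  - by apply: measurable_funTS; apply/measurable_EFinP; apply: measurableT_comp.
have -> : [set: R] = `]-oo, 0%R[%classic `|` `[0%R, +oo[%classic.
  by rewrite -setCitvl setUv.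
rewrite ge0_integral_setU//; last 3 first.
- exact: measurable_funTS.
- by move=> y _; exact: f0.
- by rewrite -setCitvl disj_set2E setICr.
rewrite integral_itv_bndo_bndc; last exact: measurable_funTS.
rewrite [X in (_ + X)%E]half//.
have mfN : measurable_fun setT (fun r : R => f (- r)).
  by apply: (measurableT_comp mf); exact: oppr_measurable.
have -> : (\int[lebesgue_measure]_(y in `]-oo, 0%R]) f y =
    \int[lebesgue_measure]_(y in `[0%R, +oo[) f (- y)%R)%E.
  rewrite (ge0_integration_by_substitution0 mfN)//.
  by apply: eq_integral => y _; rewrite opprK.
under [X in (X + _)%E]eq_integral => y _ do
  rewrite /f /laplace_density normrN mulrN -mulNr -/(laplace_density y).
rewrite half//; [|by rewrite ltrN2|by rewrite ltrNl].
rewrite -EFinD; congr EFin.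
have s2 : s ^+ 2 < 1 by nra.
by field; rewrite !lt0r_neq0//; lra.
Qed.

(** With u = s^2 <= 1/4, one has 1/(1-u) <= 1 + 2u <= exp(2u). *)
Lemma inv_one_sub_sqr_le {R : realType} (s : R) : `|s| <= 1 / 2 ->
  (1 - s ^+ 2)^-1 <= expR (2 * s ^+ 2).
Proof.
rewrite ler_norml => /andP[sl sr].
have s2 : s ^+ 2 <= 1 / 4 by nra.
have s20 : 0 <= s ^+ 2 by exact: sqr_ge0.
apply: (le_trans _ (expR_ge1Dx _)).
by rewrite invf_ple ?posrE; [rewrite -div1r ler_pdivrMr; nra|lra|lra].
Qed.

(** exp(y) <= 1/(1-y), and (1-y)(1 + y + 2y^2) = 1 + y^2 (1-2y) is at least 1 in this range. *)
Lemma expR_le_quadratic {R : realType} (y : R) : y <= 1 / 2 ->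
  expR y <= 1 + y + 2 * y ^+ 2.
Proof.
move=> y2; have e : 1 - y <= expR (- y) by exact: expR_ge1Dx.
have y1 : 0 < 1 - y by lra.
have q0 : 0 < 1 + y + 2 * y ^+ 2 by nra.
rewrite -[y]opprK expRN opprK invf_ple ?posrE ?expR_gt0//.
apply: le_trans e; rewrite -div1r ler_pdivrMr//; nra.
Qed.

(** * Exponential moments of the linear statistic *)

Section model.
Context {R : realType} {d : measure_display} {T : measurableType d} {n K : nat}.
Variables (x : 'I_n -> T -> 'I_K) (w : 'I_n -> 'I_K -> T -> R).
Variables (p : 'I_K -> R) (P : probability T R).
Hypothesis model : laplace_model x w p P.
Hypothesis p_simplex : simplex p.

Let p0 k : 0 <= p k. Proof. by case: p_simplex => /(_ k)/andP[]. Qed.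
Let p1 : \sum_(k < K) p k = 1. Proof. by case: p_simplex. Qed.

Lemma measurable_data_preimage i (B : set 'I_K) : measurable (x i @^-1` B).
Proof.
rewrite (_ : _ @^-1` _ = \bigcup_(k in B) (x i @^-1` [set k])).
  by apply: fin_bigcup_measurable => // k _; exact: data_measurable model i k.
by apply/seteqP; split => [t Bt|t [k Bk /= ->]//]; exists (x i t).
Qed.

Lemma measurable_data_fun i (phi : 'I_K -> R) : measurable_fun setT (phi \o x i).
Proof.
by move=> _ B _; rewrite setTI comp_preimage; exact: measurable_data_preimage.
Qed.

Lemma expectation_data i (phi : 'I_K -> R) : (forall k, 0 <= phi k) ->
  (\int[P]_t (phi (x i t))%:E = (\sum_(k < K) p k * phi k)%:E)%E.
Proof.
move=> phi0.
transitivity (\int[P]_t \sum_(k < K) ((phi k)%:E * (\1_(x i @^-1` [set k]) t)%:E))%E.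
  apply: eq_integral => t _.
  rewrite (bigD1 (x i t))//= indicE mem_set// mule1 big1 ?adde0// => k kx.
  by rewrite indicE memNset ?mule0//= => xk; move: kx; rewrite xk eqxx.
rewrite ge0_integral_sum//; last 2 first.
- move=> k; apply: emeasurable_funM => //; apply/measurable_EFinP.
  exact/measurable_indic/(data_measurable model).
- by move=> k t _; rewrite mule_ge0 ?lee_fin.
rewrite -sumEFin; apply: eq_bigr => k _.
have mk := data_measurable model i k.
rewrite ge0_integralZl ?lee_fin//; last exact/measurable_EFinP/measurable_indic.
rewrite integral_indic// setIT EFinM muleC.
by congr (_ * _)%E; exact: data_law model i k.
Qed.

(** The noise law is given on events only; the transfer lemma, with the identity map on the Lebesgue
    side, extends it to nonnegative functions. *)
Lemma expectation_noise i k (h : R -> R) :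
  measurable_fun setT h -> (forall y, 0 <= h y) ->
  (\int[P]_t (h (w i k t))%:E =
   \int[lebesgue_measure]_y (h y * laplace_density y)%:E)%E.
Proof.
move=> mh h0; have mw := noise_measurable model i k.
rewrite -(@integral_comp_mul_eq _ _ _ _ _ _ R P lebesgue_measure (w i k) id (cst 1))//.
- by apply: eq_integral => t _; rewrite mulr1.
- exact: measurable_laplace_density.
- exact: laplace_density_ge0.
- move=> B mB; have mwB : measurable (w i k @^-1` B).
    by rewrite -(setTI (_ @^-1` _)); exact: mw.
  apply: etrans (integral_cst P mwB 1%E) _.
  by rewrite mul1e; exact: noise_law model i k B mB.
Qed.

Definition weighted_error (alpha : R) (a : 'I_K -> R) (t : T) : R :=
  \sum_(k < K) a k * (privatized_mean x w 2 alpha k t - p k).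

Lemma measurable_privatized_mean alpha k :
  measurable_fun setT (privatized_mean x w 2 alpha k).
Proof.
apply: measurable_funM => //; apply: measurable_sum => i.
apply: measurable_funD.
  exact: (measurable_data_fun i (fun l => (l == k)%:R)).
by apply: measurable_funM => //; exact: noise_measurable model i k.
Qed.

Lemma measurable_weighted_error alpha a :
  measurable_fun setT (weighted_error alpha a).
Proof.
apply: measurable_sum => k; apply: measurable_funM => //.
by apply: measurable_funB => //; exact: measurable_privatized_mean.
Qed.

(** Exchanging the sums over samples and coordinates separates the independent sources: one centred
    data term per sample and one noise term per pair. These are the indices of [generated_by]. *)
Lemma weighted_errorE alpha a t : (0 < n)%N ->
  weighted_error alpha a t = n%:R^-1 *
    (\sum_(i < n) (a (x i t) - \sum_(k < K) p k * a k)
     + \sum_(ik : 'I_n * 'I_K) 2 / alpha * a ik.2 * w ik.1 ik.2 t).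
Proof.
move=> n0; have nn0 : n%:R != 0 :> R by rewrite pnatr_eq0 -lt0n.
rewrite -(pair_bigA _ (fun i k => 2 / alpha * a k * w i k t))/=.
rewrite -big_split/= mulr_sumr.
under [RHS]eq_bigr => i _.
  rewrite (_ : _ - _ + _ = \sum_(k < K) a k * (privatized x w 2 alpha i k t - p k)).
    over.
  rewrite (_ : a (x i t) = \sum_(k < K) a k * (x i t == k)%:R); last first.
    rewrite (bigD1 (x i t))//= eqxx mulr1 big1 ?addr0// => k.
    by rewrite eq_sym => /negbTE->; rewrite mulr0.
  rewrite -sumrB -big_split/=; apply: eq_bigr => k _.
  by rewrite /privatized; ring.
under [RHS]eq_bigr do rewrite mulr_sumr.
rewrite exchange_big/=; apply: eq_bigr => k _.
rewrite -!mulr_sumr mulrCA; congr (_ * _).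
by rewrite sumrB mulrBr /privatized_mean sumr_const card_ord -[p k *+ n]mulr_natl mulKf.
Qed.

(* The data factors cost at most exp(1 / (8 n)) each and the noise factors
   exp(2 s^2) each, with the squares s^2 summing to at most 1/4. *)
Lemma weighted_error_mgf (alpha theta A : R) (a : 'I_K -> R) : (0 < n)%N -> 0 < alpha -> alpha < 1 ->
  0 < A -> \sum_(k < K) a k ^+ 2 <= A ->
  16 * A * theta ^+ 2 = alpha ^+ 2 * n%:R ->
  (\int[P]_t (expR (theta * weighted_error alpha a t))%:E <= (expR 1)%:E)%E.
Proof.
move=> n0 alpha0 alpha1 A0 aA thetaE.
have nn0 : 0 < n%:R :> R by rewrite ltr0n.
have n1 : 1 <= n%:R :> R by rewrite ler1n.
pose m := \sum_(k < K) p k * a k.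
(* In theta S, the centred datum of a sample is multiplied by [v] and the noise variable [ik] by
   [s ik]. *)
pose v := theta / n%:R.
pose s (ik : 'I_n * 'I_K) := 2 / alpha * v * a ik.2.
have vA : 16 * A * v ^+ 2 = alpha ^+ 2 / n%:R.
  rewrite /v expr_div_n mulrA thetaE; field; exact: lt0r_neq0.
have sE ik : s ik ^+ 2 * (4 * A * n%:R) = a ik.2 ^+ 2.
  have -> : s ik ^+ 2 * (4 * A * n%:R) =
      (16 * A * v ^+ 2) * n%:R / alpha ^+ 2 * a ik.2 ^+ 2.
    by rewrite /s; field; exact: lt0r_neq0.
  by rewrite vA; field; rewrite !lt0r_neq0.
have aA1 k : a k ^+ 2 <= A.
  apply: le_trans aA; rewrite (bigD1 k)//= lerDl.
  by apply: sumr_ge0 => l _; exact: sqr_ge0.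
pose f (u : 'I_n + 'I_n * 'I_K) t := match u with
  | inl i => expR (v * (a (x i t) - m))
  | inr ik => expR (s ik * w ik.1 ik.2 t) end.
pose b (u : 'I_n + 'I_n * 'I_K) := match u with
  | inl i => (8 * n%:R)^-1 | inr ik => 2 * s ik ^+ 2 end.
have fE t : expR (theta * weighted_error alpha a t) = \prod_u f u t.
  rewrite weighted_errorE// mulrA mulrDr expRD big_sumType/= -!expR_sum.
  congr (expR _ * expR _); rewrite mulr_sumr//.
  by apply: eq_bigr => ik _; rewrite /s /v; ring.
under eq_integral do rewrite fE.
(* By [sE] and a_k^2 <= A, s^2 <= 1/(4n); this puts [s] in the range of the bound on the Laplace
   moment generating function. *)
have sle ik : `|s ik| <= 1 / 2.
  rewrite -(@ler_pXn2r _ 2) ?nnegrE// real_normK ?num_real//.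
  have sn : s ik ^+ 2 * (4 * n%:R) <= 1.
    rewrite -(ler_pM2r A0) mul1r.
    have -> : s ik ^+ 2 * (4 * n%:R) * A = s ik ^+ 2 * (4 * A * n%:R) by ring.
    by rewrite sE.
  have s2 := sqr_ge0 (s ik); nra.
have fb u : (\int[P]_t (f u t)%:E <= (expR (b u))%:E)%E.
  case: u => [i|ik] /=.
    rewrite (expectation_data i (fun k => expR (v * (a k - m)))) => [|k]; last exact: expR_ge0.
    rewrite lee_fin.
    have var : \sum_(k < K) p k * (a k - m) ^+ 2 = \sum_(k < K) p k * a k ^+ 2 - m ^+ 2.
      under eq_bigr => k _.
        rewrite (_ : _ * _ = p k * a k ^+ 2 + - (2 * m) * (p k * a k) + m ^+ 2 * p k).
          over.
        by ring.
      by rewrite !big_split/= -!mulr_sumr p1 -/m; ring.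
    have pA : \sum_(k < K) p k * a k ^+ 2 <= A.
      apply: le_trans aA; apply: ler_sum => k _.
      by rewrite ler_piMl ?sqr_ge0//; case: p_simplex => /(_ k)/andP[].
    have var0 : 0 <= \sum_(k < K) p k * (a k - m) ^+ 2.
      by apply: sumr_ge0 => k _; rewrite mulr_ge0// sqr_ge0.
    have mA : m ^+ 2 <= A by lra.
    (* Here alpha < 1 enters: a [theta] scaled to the privacy noise is also small enough for the
       data. *)
    have vA0 : v ^+ 2 * A <= (16 * n%:R)^-1.
      rewrite -(ler_pM2l (_ : 0 < 16))// mulrCA mulrA.
      rewrite (_ : v ^+ 2 * 16 * A = 16 * A * v ^+ 2); last by ring.
      rewrite vA invfM mulVKf// ler_piMl ?invr_ge0 ?ltW//; nra.
    have v20 := sqr_ge0 v.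
    (* (a_k - m)^2 <= 2 a_k^2 + 2 m^2 <= 4A, so the square of the left side is at most 4 A v^2 <=
       1/4. *)
    have ysmall k : v * (a k - m) <= 1 / 2.
      apply: le_trans (ler_norm _) _.
      rewrite -(@ler_pXn2r _ 2) ?nnegrE// real_normK ?num_real// exprMn.
      have am : (a k - m) ^+ 2 <= 4 * A.
        have := aA1 k; have := sqr_ge0 (a k + m); nra.
      have n16 : (16 * n%:R)^-1 <= 16^-1 :> R by rewrite lef_pV2 ?posrE; lra.
      by apply: (le_trans (ler_wpM2l v20 am)); lra.
    (* The linear terms cancel because [m] is the mean of [a]; what remains is 1 + 2 v^2 times the
       variance, at most 1 + 1/(8n). *)
    apply: (@le_trans _ _ (\sum_(k < K) (p k + v * (p k * a k) - v * m * p k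
        + 2 * v ^+ 2 * (p k * (a k - m) ^+ 2)))).
      apply: ler_sum => k _.
      apply: (le_trans (ler_wpM2l (p0 k) (expR_le_quadratic _ (ysmall k)))).
      by rewrite le_eqVlt; apply/orP; left; apply/eqP; ring.
    rewrite !big_split/= sumrN -!mulr_sumr p1 -/m var.
    apply: le_trans (expR_ge1Dx _).
    rewrite (_ : (8 * n%:R)^-1 = 2 * (16 * n%:R)^-1); last by field; exact: lt0r_neq0.
    have m20 := sqr_ge0 m; nra.
  rewrite (expectation_noise _ _ (fun y => expR (s ik * y)))//; last first.
    by apply: measurableT_comp => //; exact: measurable_funM.
  rewrite laplace_mgf ?lee_fin; first exact: inv_one_sub_sqr_le.
  by apply: (le_lt_trans (sle ik)); lra.
have sb : \sum_u b u <= 1.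
  rewrite big_sumType/= sumr_const card_ord -mulr_sumr -[_ *+ n]mulr_natl.
  have -> : n%:R * (8 * n%:R)^-1 = 8^-1 :> R by field; exact: lt0r_neq0.
  have : (\sum_ik s ik ^+ 2) * (4 * A * n%:R) <= n%:R * A.
    rewrite mulr_suml; under eq_bigr do rewrite sE.
    rewrite -(pair_bigA _ (fun i k => a k ^+ 2))/= sumr_const card_ord -[_ *+ n]mulr_natl.
    by rewrite ler_wpM2l// ltW.
  rewrite (_ : _ * (4 * A * _) = (\sum_ik s ik ^+ 2) * 4 * (n%:R * A)); last by ring.
  rewrite -{2}[n%:R * A]mul1r ler_pM2r; last exact: mulr_gt0.
  by move=> ?; lra.
have genm u : generated_by x w u `<=` measurable.
  case: u => [i|ik] _ [B mB <-]; rewrite setTI.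
    exact: measurable_data_preimage.
  by rewrite -(setTI (_ @^-1` _)); exact: (noise_measurable model ik.1 ik.2 measurableT mB).
rewrite (independent_expectation_prod _ _ (data_noise_independent model) genm)//.
- apply: (@le_trans _ _ (\prod_u expR (b u))%:E); last first.
    by rewrite lee_fin -expR_sum ler_expR.
  rewrite -prodEFin.
  (* Multiplying inequalities of extended reals requires nonnegative factors, so the lower bound 0
     is carried along. *)
  have : (0 <= \prod_u \int[P]_t (f u t)%:E <= \prod_u (expR (b u))%:E)%E.
    elim/big_ind2 : _ => [|y1 y2 z1 z2 /andP[y10 y12] /andP[z10 z12]|u _].
    - by rewrite lee_fin ler01 lexx.
    - by rewrite mule_ge0//= lee_pmul.
    - rewrite fb andbT; apply: integral_ge0 => t _.
      by rewrite lee_fin; case: u => *; exact: expR_ge0.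
  by move=> /andP[].
- move=> [i|ik] B mB.
    by exists ((fun k => expR (v * (a k - m))) @^-1` B) => //; rewrite setTI.
  exists ((fun y => expR (s ik * y)) @^-1` B); rewrite ?setTI//.
  rewrite -(setTI (_ @^-1` _)); apply: (_ : measurable_fun setT (fun y : R => expR (s ik * y))) => //.
  by apply: measurableT_comp => //; exact: measurable_funM.
- by move=> [i|ik] t; exact: expR_ge0.
- by move=> u; apply: le_lt_trans (fb u) _; rewrite ltry.
Qed.

End model.

(** * Absolute moments of every positive order *)

Lemma norm_powR_le_expR {R : realType} (r u : R) : 0 < r ->
  `|u| `^ r <= r `^ r * (expR u + expR (- u)).
Proof.
move=> r0.
(* Write |u| = r y and raise y <= exp(y) to the power r. *)
have e : `|u| `^ r <= r `^ r * expR `|u|.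
  pose y := `|u| / r; have uE : `|u| = r * y by rewrite /y mulrCA divff ?mulr1 ?gt_eqF.
  have y0 : 0 <= y by rewrite divr_ge0// ltW.
  rewrite uE powRM ?(ltW r0)//; apply: ler_wpM2l; first exact: powR_ge0.
  rewrite [r * y]mulrC expRM; apply: ge0_ler_powR; rewrite ?nnegrE ?expR_ge0 ?(ltW r0)//.
  by apply: le_trans (expR_ge1Dx y); lra.
apply: (le_trans e); apply: ler_wpM2l; first exact: powR_ge0.
by case: (ger0P u) => _; rewrite ?lerDl ?lerDr expR_ge0.
Qed.

(** The factor 4^r comes from the scale q = 4 sqrt(A/N), r^r from [norm_powR_le_expR], and 2e from
    the exponential moments at 1/q and -1/q. *)
Definition moment_cst {R : realType} (r : R) : R :=
  4 `^ r * (r `^ r * (2 * expR 1)).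

Lemma moment_cst_gt0 {R : realType} (r : R) : 0 < r -> 0 < moment_cst r.
Proof.
by move=> r0; rewrite !mulr_gt0 ?powR_gt0 ?expR_gt0.
Qed.

Section moments.
Context {R : realType} {d : measure_display} {T : measurableType d} {n K : nat}.
Variables (x : 'I_n -> T -> 'I_K) (w : 'I_n -> 'I_K -> T -> R).
Variables (p : 'I_K -> R) (P : probability T R).
Hypothesis model : laplace_model x w p P.
Hypothesis p_simplex : simplex p.

(** The choice theta = 1/q or -1/q with q = 4 sqrt(A/N) satisfies 16 A theta^2 = N, and
    [norm_powR_le_expR] is applied to S/q. *)
Lemma weighted_error_moment (alpha r A : R) (a : 'I_K -> R) :
  (0 < n)%N -> 0 < alpha -> alpha < 1 -> 0 < r ->
  0 < A -> \sum_(k < K) a k ^+ 2 <= A ->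
  (\int[P]_t (`|weighted_error x w p alpha a t| `^ r)%:E
   <= (moment_cst r * (A / (alpha ^+ 2 * n%:R)) `^ (r / 2))%:E)%E.
Proof.
move=> n0 alpha0 alpha1 r0 A0 aA.
have nn0 : 0 < n%:R :> R by rewrite ltr0n.
have N0 : 0 < alpha ^+ 2 * n%:R by rewrite mulr_gt0// exprn_gt0.
set N := alpha ^+ 2 * n%:R in N0 *.
have AN : 0 < A / N by rewrite divr_gt0.
pose q := 4 * (A / N) `^ (1 / 2).
have q0 : 0 < q by rewrite mulr_gt0// powR_gt0.
have q2 : q ^+ 2 = 16 * (A / N).
  rewrite exprMn -(@powR_mulrn _ (_ `^ _)) ?powR_ge0// -powRrM mul1r mulVf// powRr1 ?ltW//.
  by rewrite -natrX.
have mS : measurable_fun setT (weighted_error x w p alpha a).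
  exact: measurable_weighted_error model _ _.
have mexp (s : R) : measurable_fun setT (fun t => expR (s * weighted_error x w p alpha a t)).
  by apply: measurableT_comp => //; exact: measurable_funM.
have mgf (theta : R) : theta ^+ 2 = (q ^+ 2)^-1 ->
    (\int[P]_t (expR (theta * weighted_error x w p alpha a t))%:E <= (expR 1)%:E)%E.
  move=> thetaE; apply: (weighted_error_mgf _ _ _ _ model p_simplex _ _ A) => //.
  by rewrite thetaE q2 -/N; field; rewrite !lt0r_neq0.
apply: (@le_trans _ _ (\int[P]_t ((q `^ r * r `^ r)%:E *
   ((expR (q^-1 * weighted_error x w p alpha a t))%:E +
    (expR (- q^-1 * weighted_error x w p alpha a t))%:E)))%E).
  apply: ge0_le_integral => //.
  - apply/measurable_EFinP; apply: (measurableT_comp (measurable_powR r)).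
    by apply: measurableT_comp => //; exact: normr_measurable.
  - apply: emeasurable_funM => //; apply: emeasurable_funD; exact/measurable_EFinP.
  - move=> t _; rewrite -EFinD -EFinM lee_fin mulNr -mulrA.
    set S := weighted_error _ _ _ _ _ _.
    have -> : `|S| = q * `|q^-1 * S|.
      by rewrite normrM gtr0_norm ?invr_gt0// mulVKf ?gt_eqF.
    rewrite powRM ?(ltW q0)//; apply: ler_wpM2l; first exact: powR_ge0.
    exact: norm_powR_le_expR.
rewrite ge0_integralZl//; last 3 first.
- apply: emeasurable_funD; exact/measurable_EFinP.
- by move=> t _; rewrite adde_ge0// lee_fin expR_ge0.
- by rewrite lee_fin mulr_ge0 ?powR_ge0.
rewrite ge0_integralD//; [|exact/measurable_EFinP..].
apply: (@le_trans _ _ ((q `^ r * r `^ r)%:E * ((expR 1)%:E + (expR 1)%:E))%E).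
  apply: lee_wpmul2l; first by rewrite lee_fin mulr_ge0 ?powR_ge0.
  by apply: leeD; apply: mgf; rewrite ?sqrrN exprVn.
have -> : q `^ r = 4 `^ r * (A / N) `^ (r / 2).
  by rewrite /q powRM ?powR_ge0// -powRrM mul1r [2^-1 * r]mulrC.
rewrite -EFinD -EFinM lee_fin le_eqVlt; apply/orP; left; apply/eqP.
by rewrite /moment_cst; ring.
Qed.

Lemma privatized_mean_moment (alpha r : R) k :
  (0 < n)%N -> 0 < alpha -> alpha < 1 -> 0 < r ->
  (\int[P]_t (`|privatized_mean x w 2 alpha k t - p k| `^ r)%:E
   <= (moment_cst r * (alpha ^+ 2 * n%:R)^-1 `^ (r / 2))%:E)%E.
Proof.
move=> n0 alpha0 alpha1 r0.
have e : \sum_(l < K) ((l == k)%:R : R) ^+ 2 <= 1.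
  by rewrite (bigD1 k)//= eqxx expr1n big1 ?addr0// => l /negbTE->; rewrite expr0n.
have := weighted_error_moment _ _ _ _ n0 alpha0 alpha1 r0 ltr01 e.
rewrite div1r; apply: le_trans; rewrite le_eqVlt; apply/orP; left; apply/eqP.
apply: eq_integral => t _; rewrite /weighted_error (bigD1 k)//= eqxx mul1r.
by rewrite big1 ?addr0// => l /negbTE->; rewrite mul0r.
Qed.

End moments.

(** * Convexity and Taylor bounds for real powers *)

Lemma powR_ge_bernoulli {R : realType} (a t : R) : 1 <= a -> 0 <= t ->
  1 + a * (t - 1) <= t `^ a.
Proof.
move=> a1; rewrite le_eqVlt => /predU1P[<-|t0].
  by rewrite powR0 ?gt_eqF//; lra.
(* With t = exp(y), two uses of 1 + x <= exp(x) suffice: t^a >= t (1 + (a-1) y) and t (1-y) <= 1. *)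
rewrite /powR gt_eqF//; set y := ln t.
have tE : t = expR y by rewrite lnK.
have e1 : 1 - y <= expR (- y) by exact: expR_ge1Dx.
have e2 : 1 + (a - 1) * y <= expR ((a - 1) * y) by exact: expR_ge1Dx.
have ty : t * expR (- y) = 1 by rewrite tE -expRD subrr expR0.
have ta : t * expR ((a - 1) * y) = expR (a * y) by rewrite tE -expRD; congr expR; ring.
have := ler_wpM2l (ltW t0) e1; have := ler_wpM2l (ltW t0) e2; rewrite ty ta => h1 h2.
have : (a - 1) * (t * (1 - y)) <= (a - 1) * 1 by rewrite ler_wpM2l// subr_ge0.
lra.
Qed.

(** Bernoulli at u/v, multiplied by v^a. At v = 0 the exponent a = 1 is separate, since 0^0 = 1. *)
Lemma powR_ge_tangent {R : realType} (a u v : R) : 1 <= a -> 0 <= u -> 0 <= v ->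
  a * v `^ (a - 1) * (u - v) <= u `^ a - v `^ a.
Proof.
move=> a1 u0; rewrite le_eqVlt => /predU1P[<-|v0].
  move: a1; rewrite le_eqVlt => /predU1P[<-|a1].
    by rewrite subrr powRr0 !powRr1//; lra.
  by rewrite powR0 ?subr_eq0 ?gt_eqF// mulr0 mul0r powR0 ?gt_eqF// ?subr0 ?powR_ge0//; lra.
have a0 : 0 < a by lra.
have -> : u `^ a = v `^ a * (u / v) `^ a.
  rewrite -powRM ?divr_ge0 ?(ltW v0)//; congr (_ `^ _).
  by rewrite mulrCA divff ?mulr1 ?gt_eqF.
have b := powR_ge_bernoulli _ _ a1 (divr_ge0 u0 (ltW v0)).
have := ler_wpM2l (powR_ge0 v a) b.
rewrite -(mulr_powRB1 (ltW v0) a0); set V := v `^ (a - 1).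
have -> : v * V * (1 + a * (u / v - 1)) = v * V + a * V * (u - v).
  by field; rewrite gt_eqF.
lra.
Qed.

(** Divide by the larger point u: the ratios v/u and (u-v)/u lie in [0,1], where t <= t^a, and they
    add up to 1. *)
Lemma powR_dist_le {R : realType} (a u v : R) : 0 <= a -> a <= 1 ->
  0 <= u -> 0 <= v -> `|u `^ a - v `^ a| <= `|u - v| `^ a.
Proof.
move=> a0 a1; wlog vu : u v / v <= u => [hw u0 v0|].
  have /orP[|uv] := le_total v u; first by move/hw; exact.
  by rewrite distrC [`|u - v|]distrC; exact: hw.
move=> u0 v0; rewrite !ger0_norm ?subr_ge0//; last exact: ge0_ler_powR.
rewrite lerBlDr; have [->|un0] := eqVneq u v.
  by rewrite lerDr powR_ge0.
have {}u0 : 0 < u by rewrite lt_neqAle u0 andbT; apply: contraNneq un0 => ue; lra.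
have q t : 0 <= t -> t <= 1 -> t <= t `^ a.
  rewrite le_eqVlt => /predU1P[<- _|t0 t1]; first exact: powR_ge0.
  by apply: ger1_powR => //; rewrite t0.
have e1 : (u - v) / u <= ((u - v) / u) `^ a.
  by apply: q; [rewrite divr_ge0 ?subr_ge0// ltW|rewrite ler_pdivrMr//; lra].
have e2 : v / u <= (v / u) `^ a.
  by apply: q; [rewrite divr_ge0// ltW|rewrite ler_pdivrMr//; lra].
have d z : 0 <= z -> z `^ a = u `^ a * (z / u) `^ a.
  move=> z0; rewrite -powRM ?divr_ge0 ?(ltW u0)//; congr (_ `^ _).
  by rewrite mulrCA divff ?mulr1 ?gt_eqF.
rewrite (d v)// (d (u - v)) ?subr_ge0// -mulrDr ler_peMr ?powR_ge0//.
by apply: le_trans (lerD e1 e2); rewrite -mulrDl subrK divff// gt_eqF.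
Qed.

(** By convexity, the tangent at the larger of the two points bounds the increment. *)
Lemma powR_lipschitz {R : realType} (a u v : R) : 1 <= a -> 0 <= u -> 0 <= v ->
  `|u `^ a - v `^ a| <= a * Num.max u v `^ (a - 1) * `|u - v|.
Proof.
move=> a1; wlog vu : u v / v <= u => [hw u0 v0|].
  have /orP[|uv] := le_total v u; first by move/hw; exact.
  by rewrite distrC [`|u - v|]distrC maxC; exact: hw.
move=> u0 v0; have a0 : 0 <= a by lra.
rewrite (max_idPl vu) !ger0_norm ?subr_ge0//; last exact: ge0_ler_powR.
by have := powR_ge_tangent _ _ _ a1 v0 u0; lra.
Qed.

Lemma powR_addr_le {R : realType} (a u v : R) : 0 <= a -> 0 <= u -> 0 <= v ->
  (u + v) `^ a <= 2 `^ a * (u `^ a + v `^ a).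
Proof.
move=> a0; wlog vu : u v / v <= u => [hw u0 v0|u0 v0].
  have /orP[|uv] := le_total v u; first by move/hw; exact.
  by rewrite addrC [X in _ * X]addrC; exact: hw.
apply: (@le_trans _ _ ((2 * u) `^ a)).
  by apply: ge0_ler_powR; rewrite ?nnegrE//; lra.
rewrite powRM//; apply: ler_wpM2l; first exact: powR_ge0.
by rewrite lerDl powR_ge0.
Qed.

(** The tangents at [v] and at [u] place the remainder between 0 and gamma (u^(gamma-1) -
    v^(gamma-1)) (u-v). *)
Lemma powR_taylor1 {R : realType} (gamma u v : R) : 1 <= gamma -> 0 <= u -> 0 <= v ->
  `|u `^ gamma - v `^ gamma - gamma * v `^ (gamma - 1) * (u - v)|
  <= gamma * `|u `^ (gamma - 1) - v `^ (gamma - 1)| * `|u - v|.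
Proof.
move=> g1 u0 v0.
have h1 := powR_ge_tangent _ _ _ g1 u0 v0.
have h2 := powR_ge_tangent _ _ _ g1 v0 u0.
rewrite ger0_norm ?subr_ge0// -[leRHS]mulrA -normrM.
set X := u `^ (gamma - 1) in h2 *; set Y := v `^ (gamma - 1) in h1 *.
have : gamma * ((X - Y) * (u - v)) <= gamma * `|(X - Y) * (u - v)|.
  by rewrite ler_wpM2l ?ler_norm//; lra.
by apply: le_trans; lra.
Qed.

(** Here gamma - 1 lies in [0,1], so [powR_dist_le] bounds the difference of derivatives. *)
Lemma powR_taylor_le2 {R : realType} (gamma u v : R) : 1 <= gamma -> gamma <= 2 ->
  0 <= u -> 0 <= v ->
  `|u `^ gamma - v `^ gamma - gamma * v `^ (gamma - 1) * (u - v)|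
  <= gamma * `|u - v| `^ gamma.
Proof.
move=> g1 g2 u0 v0; apply: le_trans (powR_taylor1 _ _ _ g1 u0 v0) _.
rewrite -(@mulr_powRB1 _ `|u - v| gamma)//; last by lra.
rewrite -mulrA [`|u - v| * _]mulrC; apply: ler_wpM2l; first by lra.
by apply: ler_wpM2r => //; apply: powR_dist_le => //; lra.
Qed.

(** Now the derivative is locally Lipschitz; max(u,v) <= v + |u-v| then splits the constant into the
    two terms. *)
Lemma powR_taylor_ge2 {R : realType} (gamma u v : R) : 2 <= gamma ->
  0 <= u -> 0 <= v ->
  `|u `^ gamma - v `^ gamma - gamma * v `^ (gamma - 1) * (u - v)|
  <= gamma * (gamma - 1) * 2 `^ (gamma - 2) *
     (`|u - v| `^ gamma + v `^ (gamma - 2) * (u - v) ^+ 2).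
Proof.
move=> g2 u0 v0.
have g1 : 1 <= gamma by lra.
have g1' : 1 <= gamma - 1 by lra.
apply: le_trans (powR_taylor1 _ _ _ g1 u0 v0) _.
rewrite -!mulrA; apply: ler_wpM2l; first by lra.
have L := powR_lipschitz _ _ _ g1' u0 v0.
apply: (le_trans (ler_wpM2r (normr_ge0 _) L)).
rewrite (_ : gamma - 1 - 1 = gamma - 2); last by ring.
rewrite -!mulrA; apply: ler_wpM2l; first by lra.
have D0 := normr_ge0 (u - v); set D := `|u - v| in D0 *.
have -> : (u - v) ^+ 2 = D * D by rewrite -expr2 real_normK ?num_real.
have -> : D `^ gamma = D `^ (gamma - 2) * (D * D).
  rewrite -(@mulr_powRB1 _ D gamma)//; last by lra.
  rewrite -(@mulr_powRB1 _ D (gamma - 1))//; last by lra.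
  by rewrite (_ : gamma - 1 - 1 = gamma - 2); ring.
rewrite -mulrDl [leRHS]mulrA; apply: ler_wpM2r; first exact: mulr_ge0.
have g0 : 0 <= gamma - 2 by lra.
rewrite [X in _ <= _ * X]addrC; apply: (le_trans _ (powR_addr_le _ _ _ g0 v0 D0)).
apply: ge0_ler_powR; rewrite ?nnegrE ?le_max ?u0//; first exact: addr_ge0.
by rewrite ge_max lerDl D0 andbT -lerBlDl ler_norm.
Qed.

(** * Truncation and the expansion of a single summand *)

Lemma truncate02_ge0 {R : realType} (z : R) : 0 <= truncate02 z.
Proof. by rewrite /truncate02 le_min le_max lexx orbT/=. Qed.

(** If z <= 0 then |z-v| >= v. If z > 2 then |z-v| > 1 >= v: the upper level 2 keeps a margin of 1
    above every probability. *)
Lemma truncate02_dist {R : realType} (z v : R) : 0 <= v -> v <= 1 ->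
  [/\ `|truncate02 z - v| <= `|z - v|, `|truncate02 z - z| <= `|z - v| &
      truncate02 z = z \/ v <= `|z - v|].
Proof.
move=> v0 v1; rewrite /truncate02.
have [z0|z0] := leP z 0.
  rewrite (min_idPl _) ?ler0n// sub0r normrN ger0_norm// sub0r normrN !ler0_norm; [|lra..].
  by split; [lra|lra|right; lra].
have [z2|z2] := leP z 2.
  by rewrite subrr normr0; split => //; left.
have zv : `|z - v| = z - v by rewrite ger0_norm; lra.
by rewrite zv ger0_norm ?ler0_norm; [split; [lra|lra|right; lra]|lra..].
Qed.

Lemma plug_in_taylor {R : realType} (gamma : R) : 0 < gamma ->
  exists2 C : R, 0 < C & forall z v : R, 0 <= v -> v <= 1 ->
  `|truncate02 z `^ gamma - v `^ gamma
    - (1 <= gamma)%R%:R * (gamma * v `^ (gamma - 1) * (z - v))|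
  <= C * (`|z - v| `^ gamma + (2 <= gamma)%R%:R * v `^ (gamma - 2) * (z - v) ^+ 2).
Proof.
move=> g0.
have [g1|g1] := leP 1 gamma; last first.
  exists 1 => // z v v0 v1; have [h _ _] := truncate02_dist z v v0 v1.
  have -> : (2 <= gamma) = false by apply/negbTE; rewrite -ltNge; lra.
  rewrite !mul0r subr0 addr0 mul1r.
  apply: (le_trans (powR_dist_le _ _ _ (ltW g0) (ltW g1) (truncate02_ge0 z) v0)).
  by apply: ge0_ler_powR; rewrite ?nnegrE// ltW.
(* This is the cost of putting the untruncated [z] in the linear term: it vanishes unless v <=
   |z-v|, and then v^(gamma-1) is at most |z-v|^(gamma-1). *)
have lin z v : 0 <= v -> v <= 1 ->
    `|gamma * v `^ (gamma - 1) * (truncate02 z - z)| <= gamma * `|z - v| `^ gamma.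
  move=> v0 v1; have [_ h [->|vz]] := truncate02_dist z v v0 v1.
    by rewrite subrr mulr0 normr0 mulr_ge0 ?powR_ge0// ltW.
  rewrite !normrM (gtr0_norm g0) (ger0_norm (powR_ge0 _ _)) -mulrA.
  apply: ler_wpM2l; first exact: ltW.
  rewrite -(@mulr_powRB1 _ `|z - v| gamma)// [X in _ <= X]mulrC.
  apply: ler_pM => //; first exact: powR_ge0.
  by apply: ge0_ler_powR; rewrite ?nnegrE//; lra.
have split3 z v : truncate02 z `^ gamma - v `^ gamma - 1 * (gamma * v `^ (gamma - 1) * (z - v)) =
  (truncate02 z `^ gamma - v `^ gamma - gamma * v `^ (gamma - 1) * (truncate02 z - v))
  + gamma * v `^ (gamma - 1) * (truncate02 z - z) by ring.
have [g2|g2] := leP 2 gamma.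
  pose C := gamma * (gamma - 1) * 2 `^ (gamma - 2).
  have C0 : 0 < C by rewrite !mulr_gt0 ?powR_gt0 ?subr_gt0//; lra.
  exists (C + gamma); first by lra.
  move=> z v v0 v1; rewrite split3 mul1r; apply: (le_trans (ler_normD _ _)).
  rewrite mulrDl; apply: lerD; last first.
    apply: (le_trans (lin z v v0 v1)); rewrite ler_wpM2l ?(ltW g0)// lerDl.
    by rewrite mulr_ge0 ?powR_ge0 ?sqr_ge0.
  apply: (le_trans (powR_taylor_ge2 _ _ _ g2 (truncate02_ge0 z) v0)).
  rewrite -/C ler_wpM2l ?(ltW C0)//.
  have [h _ _] := truncate02_dist z v v0 v1; apply: lerD.
    by apply: ge0_ler_powR; rewrite ?nnegrE// ltW.
  apply: ler_wpM2l; first exact: powR_ge0.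
  by rewrite -[leLHS]real_normK ?num_real// -[leRHS]real_normK ?num_real// lerXn2r ?nnegrE.
(* One [gamma] pays for the Taylor remainder and one for [lin]. *)
exists (2 * gamma) => [|z v v0 v1]; first by lra.
rewrite split3 !mul0r addr0 [2 * _]mulr_natl mulr2n mulrDl; apply: (le_trans (ler_normD _ _)).
apply: lerD; last exact: lin.
have [h _ _] := truncate02_dist z v v0 v1.
apply: (le_trans (powR_taylor_le2 _ _ _ g1 (ltW g2) (truncate02_ge0 z) v0)).
rewrite ler_wpM2l ?(ltW g0)//.
by apply: ge0_ler_powR; rewrite ?nnegrE// ltW.
Qed.

(** * Squaring, integrating and splitting at the threshold *)

Lemma sqr_sum_le {R : realDomainType} {I : finType} (b y : I -> R) :
  (forall i, 0 <= b i) ->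
  (\sum_i b i * y i) ^+ 2 <= (\sum_i b i) * \sum_i b i * y i ^+ 2.
Proof.
move=> b0.
have sq : 0 <= \sum_i \sum_j b i * b j * (y i - y j) ^+ 2.
  apply: sumr_ge0 => i _; apply: sumr_ge0 => j _.
  by apply: mulr_ge0 (sqr_ge0 _); exact: mulr_ge0.
(* Lagrange's identity: the double sum is twice the gap in the weighted Cauchy-Schwarz
   inequality. *)
suff e : \sum_i \sum_j b i * b j * (y i - y j) ^+ 2 =
    ((\sum_i b i) * (\sum_i b i * y i ^+ 2) - (\sum_i b i * y i) ^+ 2) *+ 2.
  by move: sq; rewrite e pmulrn_lge0// subr_ge0.
rewrite mulr2n expr2.
rewrite [in X in X + _](mulrC (\sum_i b i)) !big_distrlr/= -!sumrB -big_split/=.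
apply: eq_bigr => i _; rewrite -!sumrB -big_split/=.
by apply: eq_bigr => j _; ring.
Qed.

Lemma integral_le_sum {d} {T : measurableType d} {R : realType} {I : finType}
    (mu : {measure set T -> \bar R}) (g : T -> R) (c B : I -> R) (h : I -> T -> R) :
  measurable_fun setT g -> (forall i, measurable_fun setT (h i)) ->
  (forall t, 0 <= g t) -> (forall i t, 0 <= h i t) -> (forall i, 0 <= c i) ->
  (forall t, g t <= \sum_i c i * h i t) ->
  (forall i, \int[mu]_t (h i t)%:E <= (B i)%:E)%E ->
  (\int[mu]_t (g t)%:E <= (\sum_i c i * B i)%:E)%E.
Proof.
move=> mg mh g0 h0 c0 gh hB.
apply: (@le_trans _ _ (\int[mu]_t (\sum_i (c i)%:E * (h i t)%:E))%E).
  apply: ge0_le_integral => //.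
  - by move=> t _; rewrite lee_fin.
  - exact/measurable_EFinP.
  - apply: emeasurable_sum => i; apply: emeasurable_funM => //.
    exact/measurable_EFinP.
  - move=> t _; under eq_bigr do rewrite -EFinM.
    by rewrite sumEFin lee_fin.
rewrite ge0_integral_sum//; last 2 first.
- by move=> i; apply: emeasurable_funM => //; exact/measurable_EFinP.
- by move=> i t _; rewrite mule_ge0// lee_fin.
rewrite -sumEFin; apply: lee_sum => i _.
rewrite ge0_integralZl ?lee_fin//; last 2 first.
- exact/measurable_EFinP.
- by move=> t _; rewrite lee_fin.
by rewrite EFinM lee_wpmul2l// lee_fin.
Qed.

Lemma sqr_addr3_le {R : realDomainType} (a b c : R) :
  (a + b + c) ^+ 2 <= 3 * a ^+ 2 + 3 * b ^+ 2 + 3 * c ^+ 2.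
Proof.
have := sqr_ge0 (a - b); have := sqr_ge0 (a - c); have := sqr_ge0 (b - c).
rewrite !expr2; lra.
Qed.

Lemma powR_div_sqrt {R : realType} (c N e : R) : 0 < c -> 0 < N ->
  (c / Num.sqrt N) `^ e = c `^ e * (N `^ (e / 2))^-1.
Proof.
move=> c0 N0; rewrite -powR12_sqrt ?(ltW N0)// -[_^-1 in LHS]powR_inv1 ?powR_ge0//.
rewrite powRM ?powR_ge0 ?(ltW c0)// -!powRrM -powRN; congr (_ * N `^ _).
by ring.
Qed.

(** Each coordinate below [tau] costs at most tau^r. For r = 0 a zero coordinate counts as 0^0 = 1,
    which K tau^0 = K also covers. *)
Lemma sum_powR_split_le {R : realType} {K : nat} (tau r : R) (p : 'I_K -> R) :
  0 <= r -> 0 < tau -> (forall k, 0 <= p k) ->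
  \sum_(k < K) p k `^ r <= power_sum_above tau r p + K%:R * tau `^ r.
Proof.
move=> r0 t0 p0; rewrite (bigID (fun k => tau <= p k))/= lerD2l.
rewrite mulr_natl -[X in _ *+ X](card_ord K) -sumr_const.
rewrite [leRHS](bigID (fun k => ~~ (tau <= p k)))/= -[leLHS]addr0.
apply: lerD; last by apply: sumr_ge0 => k _; exact: powR_ge0.
by apply: ler_sum => k; rewrite -ltNge => /ltW kt; apply: ge0_ler_powR; rewrite ?nnegrE// ltW.
Qed.

(** * From the pointwise expansion to the risk *)

Section risk.
Context {R : realType} {d : measure_display} {T : measurableType d} {n K : nat}.
Variables (x : 'I_n -> T -> 'I_K) (w : 'I_n -> 'I_K -> T -> R).
Variables (p : 'I_K -> R) (P : probability T R).
Hypothesis model : laplace_model x w p P.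
Hypothesis p_simplex : simplex p.

Let p0 k : 0 <= p k. Proof. by case: p_simplex => /(_ k)/andP[]. Qed.
Let p1 k : p k <= 1. Proof. by case: p_simplex => /(_ k)/andP[]. Qed.

Lemma measurable_plug_in (alpha gamma : R) :
  measurable_fun setT (plug_in x w alpha gamma).
Proof.
apply: measurable_sum => k; apply: (measurableT_comp (measurable_powR gamma)).
apply: measurable_minr => //; apply: measurable_maxr => //.
exact: measurable_privatized_mean model _ _.
Qed.


(** Everything stays pointwise here, and the powers on the right are real powers so that the moment
    bounds apply term by term. *)
Lemma plug_in_error_sqr_le (alpha gamma C : R) (t : T) : 0 <= C ->
  (forall z v : R, 0 <= v -> v <= 1 ->
    `|truncate02 z `^ gamma - v `^ gamma
      - (1 <= gamma)%R%:R * (gamma * v `^ (gamma - 1) * (z - v))|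
    <= C * (`|z - v| `^ gamma + (2 <= gamma)%R%:R * v `^ (gamma - 2) * (z - v) ^+ 2)) ->
  let D k := `|privatized_mean x w 2 alpha k t - p k| in
  let b k := (2 <= gamma)%R%:R * p k `^ (gamma - 2) in
  ((plug_in x w alpha gamma t - power_sum gamma p) ^+ 2 <=
  3 * gamma ^+ 2 *
    `|weighted_error x w p alpha (fun k => (1 <= gamma)%R%:R * p k `^ (gamma - 1)) t| `^ 2
  + 3 * C ^+ 2 * K%:R * (\sum_k D k `^ (2 * gamma))
  + 3 * C ^+ 2 * (\sum_k b k) * \sum_k b k * D k `^ 4 : Prop).
Proof.
move=> C0 taylor D b.
have D0 k : 0 <= D k by exact: normr_ge0.
have b0 k : 0 <= b k by rewrite mulr_ge0 ?powR_ge0.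
set a := fun k => (1 <= gamma)%R%:R * _.
set L := weighted_error x w p alpha a t.
pose rem k := truncate02 (privatized_mean x w 2 alpha k t) `^ gamma - p k `^ gamma
   - gamma * (a k * (privatized_mean x w 2 alpha k t - p k)).
have errE : plug_in x w alpha gamma t - power_sum gamma p = gamma * L + \sum_k rem k.
  by rewrite /rem !sumrB -mulr_sumr subrKC.
pose X := \sum_k D k `^ gamma; pose Y := \sum_k b k * D k ^+ 2.
have X0 : 0 <= X by apply: sumr_ge0 => k _; exact: powR_ge0.
have Y0 : 0 <= Y by apply: sumr_ge0 => k _; rewrite mulr_ge0// exprn_ge0.
have remle : `|\sum_k rem k| <= C * X + C * Y.
  apply: le_trans (ler_norm_sum _ _ _) _; rewrite -mulrDr -big_split mulr_sumr.
  apply: ler_sum => k _ /=.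
  have := taylor (privatized_mean x w 2 alpha k t) (p k) (p0 k) (p1 k).
  rewrite /rem /a /b /D real_normK ?num_real//; apply: le_trans.
  by rewrite le_eqVlt; apply/orP; left; apply/eqP; congr `|_|; ring.
have errle : `|plug_in x w alpha gamma t - power_sum gamma p|
    <= `|gamma * L| + C * X + C * Y.
  by rewrite errE -addrA; apply: le_trans (ler_normD _ _) _; rewrite lerD2l.
rewrite -[leLHS]real_normK ?num_real//.
apply: (@le_trans _ _ ((`|gamma * L| + C * X + C * Y) ^+ 2)).
  by rewrite lerXn2r ?nnegrE// !addr_ge0// mulr_ge0.
apply: le_trans (sqr_addr3_le _ _ _) _.
have XX : X ^+ 2 <= K%:R * \sum_k D k `^ (2 * gamma).
  have := @sqr_sum_le R 'I_K (fun=> 1) (fun k => D k `^ gamma) (fun=> ler01).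
  rewrite sumr_const card_ord.
  under eq_bigr do rewrite mul1r.
  under [X in _ <= _ * X -> _]eq_bigr => k _.
    rewrite mul1r -powR_mulrn ?powR_ge0// -powRrM mulrC.
    over.
  by [].
(* Cauchy-Schwarz with weights [b] keeps one factor [b] inside; after integration the two sums
   combine into the square of the sum of [b], with no factor [K]. *)
have YY : Y ^+ 2 <= (\sum_k b k) * \sum_k b k * D k `^ 4.
  have := @sqr_sum_le R 'I_K b (fun k => D k ^+ 2) b0.
  under [X in _ <= _ * X -> _]eq_bigr => k _.
    rewrite -exprM -powR_mulrn//.
    over.
  by [].
rewrite real_normK ?num_real// powR_mulrn// real_normK ?num_real//.
have C30 : 0 <= 3 * C ^+ 2 by rewrite mulr_ge0 ?sqr_ge0.
rewrite !exprMn; apply: lerD; first apply: lerD.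
- by rewrite mulrA.
- by rewrite mulrA -[leRHS]mulrA ler_wpM2l.
- by rewrite mulrA -[leRHS]mulrA ler_wpM2l.
Qed.

Lemma quadratic_risk_moment_bound (gamma C alpha A : R) :
  0 < gamma -> 0 <= C ->
  (forall z v : R, 0 <= v -> v <= 1 ->
    `|truncate02 z `^ gamma - v `^ gamma
      - (1 <= gamma)%R%:R * (gamma * v `^ (gamma - 1) * (z - v))|
    <= C * (`|z - v| `^ gamma + (2 <= gamma)%R%:R * v `^ (gamma - 2) * (z - v) ^+ 2)) ->
  (0 < n)%N -> 0 < alpha -> alpha < 1 -> 0 < A ->
  \sum_(k < K) ((1 <= gamma)%R%:R * p k `^ (gamma - 1)) ^+ 2 <= A ->
  let N := alpha ^+ 2 * n%:R in
  let b := \sum_(k < K) (2 <= gamma)%R%:R * p k `^ (gamma - 2) in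
  ((quadratic_risk x w alpha gamma p P <=
   (3 * gamma ^+ 2 * moment_cst 2 * (A / N)
    + 3 * C ^+ 2 * moment_cst (2 * gamma) * (K%:R ^+ 2 / N `^ gamma)
    + 3 * C ^+ 2 * moment_cst 4 * (b ^+ 2 / N ^+ 2))%:E)%E : Prop).
Proof.
move=> gamma0 C0 taylor n0 alpha0 alpha1 A0 aA N b.
have nn0 : 0 < n%:R :> R by rewrite ltr0n.
have N0 : 0 < N by rewrite mulr_gt0// exprn_gt0.
pose bk k := (2 <= gamma)%R%:R * p k `^ (gamma - 2).
have b0 k : 0 <= bk k by rewrite mulr_ge0 ?powR_ge0.
have bs0 : 0 <= b by apply: sumr_ge0 => k _; exact: b0.
(* The index type lists the linear term, the remainders of order 2 gamma and those of order 4; [c],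
   [B] and [h] hold their coefficients, moment bounds and random variables. *)
pose c (j : unit + ('I_K + 'I_K)) : R := match j with
  | inl _ => 3 * gamma ^+ 2
  | inr (inl k) => 3 * C ^+ 2 * K%:R
  | inr (inr k) => 3 * C ^+ 2 * b * bk k end.
pose B (j : unit + ('I_K + 'I_K)) : R := match j with
  | inl _ => moment_cst 2 * (A / N) `^ (2 / 2)
  | inr (inl k) => moment_cst (2 * gamma) * N^-1 `^ (2 * gamma / 2)
  | inr (inr k) => moment_cst 4 * N^-1 `^ (4 / 2) end.
pose h (j : unit + ('I_K + 'I_K)) (t : T) : R := match j with
  | inl _ => `|weighted_error x w p alpha (fun k => (1 <= gamma)%R%:R * p k `^ (gamma - 1)) t| `^ 2
  | inr (inl k) => `|privatized_mean x w 2 alpha k t - p k| `^ (2 * gamma)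
  | inr (inr k) => `|privatized_mean x w 2 alpha k t - p k| `^ 4 end.
have sumT (F : unit + ('I_K + 'I_K) -> R) : \sum_j F j =
    F (inl tt) + (\sum_k F (inr (inl k)) + \sum_k F (inr (inr k))).
  by rewrite big_sumType/= big_sumType/= (big_pred1 tt)//.
have mZ k : measurable_fun setT (fun t => privatized_mean x w 2 alpha k t - p k).
  by apply: measurable_funB => //; exact: measurable_privatized_mean model _ _.
have mpow (r : R) (f : T -> R) : measurable_fun setT f ->
    measurable_fun setT (fun t : T => `|f t| `^ r).
  move=> mf; apply: (measurableT_comp (measurable_powR r)).
  by apply: measurableT_comp => //; exact: normr_measurable.
have := @integral_le_sum _ T R _ P
  (fun t => (plug_in x w alpha gamma t - power_sum gamma p) ^+ 2) c B h.
rewrite /quadratic_risk expectation.unlock => H; apply: (le_trans (H _ _ _ _ _ _ _)).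
- apply: measurable_funX; apply: measurable_funB => //; exact: measurable_plug_in.
- move=> [[]|[k|k]] /=; apply: mpow => //.
  exact: measurable_weighted_error model _ _.
- by move=> t; exact: sqr_ge0.
- by move=> [[]|[k|k]] t; exact: powR_ge0.
- have g20 : 0 <= 3 * gamma ^+ 2 by rewrite mulr_ge0 ?sqr_ge0.
  have C20 : 0 <= 3 * C ^+ 2 by rewrite mulr_ge0 ?sqr_ge0.
  move=> [[]|[k|k]] //=; first exact: mulr_ge0.
  by apply: mulr_ge0 => //; exact: mulr_ge0.
- move=> t; rewrite sumT /= addrA -!mulr_sumr.
  apply: le_trans (plug_in_error_sqr_le alpha gamma C t C0 taylor) _.
  rewrite lerD2l mulr_sumr; apply: ler_sum => k _.
  by rewrite mulrA.
- move=> [[]|[k|k]].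
  + exact: weighted_error_moment.
  + by apply: privatized_mean_moment => //; rewrite mulr_gt0.
  + exact: privatized_mean_moment.
rewrite lee_fin sumT /= addrA !sumr_const card_ord.
rewrite -mulr_suml -[\sum_k _]mulr_sumr -/b !mulfV// powRr1; last by rewrite divr_ge0// ltW.
have -> : (4 / 2 : R) = 2%:R by field.
rewrite powR_mulrn ?invr_ge0 ?(ltW N0)//.
have -> : 2 * gamma / 2 = gamma by field.
have -> : N^-1 `^ gamma = (N `^ gamma)^-1.
  by rewrite -powR_inv1 ?(ltW N0)// -powRrM mulN1r powRN.
rewrite le_eqVlt; apply/orP; left; apply/eqP.
rewrite -[_ *+ K]mulr_natl exprVn.
by ring.
Qed.

End risk.

(** * Power sums of the coordinates above the threshold *)

Lemma power_sum_above_ge0 {R : realType} {K : nat} (tau r : R) (p : 'I_K -> R) :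
  0 <= power_sum_above tau r p.
Proof. by apply: sumr_ge0 => k _; exact: powR_ge0. Qed.

Section simplex_power_sums.
Context {R : realType} {K : nat} (tau r : R) (p : 'I_K -> R).
Hypotheses (p_simplex : simplex p) (tau0 : 0 < tau).

Let p0 k : 0 <= p k. Proof. by case: p_simplex => /(_ k)/andP[]. Qed.
Let p1 k : p k <= 1. Proof. by case: p_simplex => /(_ k)/andP[]. Qed.
Let sum_p : \sum_(k < K) p k = 1. Proof. by case: p_simplex. Qed.
Let sum_above : \sum_(k < K | tau <= p k) p k <= 1.
Proof.
by rewrite -sum_p [leRHS](bigID (fun k => tau <= p k))/= lerDl sumr_ge0.
Qed.

Lemma power_sum_above_le1 : 1 <= r -> power_sum_above tau r p <= 1.
Proof.
move=> r1; apply: le_trans sum_above; apply: ler_sum => k tk.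
by apply: ge1r_powR => //; rewrite p1 andbT (lt_le_trans tau0).
Qed.

(** With M = min(1/tau, K), at most M coordinates are counted. Summing (M p_k)^r <= 1 + M p_k over
    them gives at most 2M, and dividing by M^r gives the claim. *)
Lemma power_sum_above_le : (0 < K)%N -> 0 <= r -> r <= 1 ->
  power_sum_above tau r p <= 2 * Num.min tau^-1 K%:R `^ (1 - r).
Proof.
move=> K0 r0 r1; set M := Num.min _ _.
have M0 : 0 < M by rewrite lt_min invr_gt0 tau0 ltr0n.
pose m : R := \sum_(k < K | tau <= p k) 1.
have mM : m <= M.
  rewrite le_min; apply/andP; split.
    rewrite -[tau^-1]mul1r ler_pdivlMr// mulr_suml; apply: le_trans sum_above.
    by apply: ler_sum => k; rewrite mul1r.
  rewrite -[X in X%:R](card_ord K) -sumr_const [leRHS](bigID (fun k => tau <= p k))/=.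
  by rewrite lerDl sumr_ge0.
have bound k : p k `^ r <= (M `^ r)^-1 * (1 + p k * M).
  rewrite ler_pdivlMl ?powR_gt0// -powRM ?(ltW M0)// mulrC.
  have [h|h] := leP (p k * M) 1.
    apply: (@le_trans _ _ (1 `^ r)); last by rewrite powR1 lerDl mulr_ge0// ltW.
    by apply: ge0_ler_powR; rewrite ?nnegrE// mulr_ge0// ltW.
  by apply: (le_trans (ler1_powR (ltW h) r1)); lra.
apply: (@le_trans _ _ (\sum_(k < K | tau <= p k) (M `^ r)^-1 * (1 + p k * M))).
  by apply: ler_sum => k _; exact: bound.
rewrite -mulr_sumr big_split/= -mulr_suml -/m.
rewrite powRB; last by rewrite (gt_eqF M0) implybT.
rewrite powRr1 ?(ltW M0)// mulrA mulrC; apply: ler_wpM2r; first by rewrite invr_ge0 powR_ge0.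
have := ler_wpM2r (ltW M0) sum_above; lra.
Qed.

End simplex_power_sums.

(** * Collecting the constants and passing to the supremum *)

Theorem theorem2p1 (R : realType) (c : R) (hc : 1 <= c)
    (gamma : R) (hgamma : 0 < gamma) :
  exists C : R, 0 < C /\
  forall (K n : nat) (alpha : R), (0 < K)%N -> (0 < n)%N ->
    0 < alpha -> alpha < 1 -> 1 <= alpha ^+ 2 * n%:R ->
  forall (d : measure_display) (T : measurableType d)
    (x : 'I_n -> T -> 'I_K) (w : 'I_n -> 'I_K -> T -> R),
  let N := alpha ^+ 2 * n%:R in
  let tau := c / Num.sqrt N in
  (forall (p : 'I_K -> R) (P : probability T R),
     simplex p -> laplace_model x w p P ->
     (quadratic_risk x w alpha gamma p P <=
      (C * (K%:R ^+ 2 / N `^ gamma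
            + (2 <= gamma)%R%:R
                * (power_sum_above tau (gamma - 2) p ^+ 2 / N ^+ 2)
            + (1 <= gamma)%R%:R
                * (power_sum_above tau (2 * gamma - 2) p / N)))%:E)%E)
  /\
  (forall P : ('I_K -> R) -> probability T R,
     (forall p, simplex p -> laplace_model x w p (P p)) ->
     (ereal_sup [set quadratic_risk x w alpha gamma p (P p) | p in @simplex R K] <=
      (C * (K%:R ^+ 2 / N `^ gamma
            + (1 <= gamma)%R%:R
                * (Num.max (Num.min tau^-1 K%:R `^ (3 - 2 * gamma)) 1 / N)))%:E)%E).
Proof.
have [C0 C00 taylor] := plug_in_taylor gamma hgamma.
have c0 : 0 < c by lra.
pose k1 : R := 3 * gamma ^+ 2 * moment_cst 2.
pose k2 : R := 3 * C0 ^+ 2 * moment_cst (2 * gamma).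
pose k3 : R := 3 * C0 ^+ 2 * moment_cst 4.
have k10 : 0 < k1 by apply: mulr_gt0; [apply: mulr_gt0 => //; exact: exprn_gt0|exact: moment_cst_gt0].
have k20 : 0 < k2.
  by apply: mulr_gt0; [apply: mulr_gt0 => //; exact: exprn_gt0|apply: moment_cst_gt0; lra].
have k30 : 0 < k3 by apply: mulr_gt0; [apply: mulr_gt0 => //; exact: exprn_gt0|exact: moment_cst_gt0].
(* These are the powers of [c] left when [tau] is expressed through [N]: tau^(2 gamma-2) = c1
   N^(1-gamma) and tau^(2 gamma-4) = c2 N^(2-gamma). *)
pose c1 : R := c `^ (2 * gamma - 2).
pose c2 : R := c `^ (2 * gamma - 4).
have c10 : 0 < c1 by exact: powR_gt0.
have c20 : 0 < c2 by exact: powR_gt0.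
pose C1 := k1 * (1 + c1) + k2 + 2 * k3 * (1 + c2).
have C10 : 0 < C1.
  by have := mulr_gt0 k10 c10; have := mulr_gt0 k30 c20; rewrite /C1; lra.
have first_bound (K n : nat) (alpha : R) : (0 < K)%N -> (0 < n)%N ->
    0 < alpha -> alpha < 1 -> 1 <= alpha ^+ 2 * n%:R ->
  forall (d : measure_display) (T : measurableType d)
    (x : 'I_n -> T -> 'I_K) (w : 'I_n -> 'I_K -> T -> R)
    (p : 'I_K -> R) (P : probability T R),
  simplex p -> laplace_model x w p P ->
  let N := alpha ^+ 2 * n%:R in
  let tau := c / Num.sqrt N in
  ((quadratic_risk x w alpha gamma p P <=
    (C1 * (K%:R ^+ 2 / N `^ gamma
          + (2 <= gamma)%R%:R * (power_sum_above tau (gamma - 2) p ^+ 2 / N ^+ 2)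
          + (1 <= gamma)%R%:R * (power_sum_above tau (2 * gamma - 2) p / N)))%:E)%E : Prop).
  move=> K0 n0 alpha0 alpha1 N1 d T x w p P ps model N tau.
  have N0 : 0 < N by apply: lt_le_trans N1.
  have tau0 : 0 < tau by rewrite divr_gt0// sqrtr_gt0.
  have K1 : 1 <= K%:R :> R by rewrite ler1n.
  have p0 k : 0 <= p k by case: ps => /(_ k)/andP[].
  pose X := K%:R ^+ 2 / N `^ gamma.
  pose B := power_sum_above tau (gamma - 2) p.
  pose S := power_sum_above tau (2 * gamma - 2) p.
  have B0 : 0 <= B by exact: power_sum_above_ge0.
  have S0 : 0 <= S by exact: power_sum_above_ge0.
  have Ng0 : 0 < N `^ gamma by exact: powR_gt0.
  (* The second summand also keeps [A] positive when gamma < 1, as the moment bound requires;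
     divided by [N] it is c1 K / N^gamma <= c1 X. *)
  pose A := (1 <= gamma)%R%:R * S + K%:R * tau `^ (2 * gamma - 2).
  have A0 : 0 < A.
    by apply: ltr_wpDl; [exact: mulr_ge0|rewrite mulr_gt0 ?powR_gt0 ?ltr0n].
  have aA : \sum_(k < K) ((1 <= gamma)%R%:R * p k `^ (gamma - 1)) ^+ 2 <= A.
    rewrite /A; have [g1|g1] := leP 1 gamma; last first.
      rewrite big1 => [|k _]; first by rewrite mul0r add0r mulr_ge0 ?powR_ge0.
      by rewrite mul0r expr0n.
    rewrite mul1r; under eq_bigr => k _.
      rewrite mul1r -powR_mulrn ?powR_ge0// -powRrM.
      rewrite (_ : (gamma - 1) * 2%:R = 2 * gamma - 2); last by ring.
      over.
    by apply: sum_powR_split_le => //; lra.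
  have X0 : 0 <= X by apply: divr_ge0; [exact: exprn_ge0|exact: ltW].
  have KX : K%:R / N `^ gamma <= X.
    by rewrite ler_wpM2r ?invr_ge0 ?(ltW Ng0)// expr2 ler_peMl.
  have AX : A / N <= (1 <= gamma)%R%:R * (S / N) + c1 * X.
    rewrite /A mulrDl -mulrA lerD2l /tau powR_div_sqrt// -/c1.
    have -> : N `^ ((2 * gamma - 2) / 2) = N `^ gamma / N.
      rewrite (_ : (2 * gamma - 2) / 2 = gamma - 1); last by field.
      rewrite powRB; last by rewrite (gt_eqF N0) implybT.
      by rewrite powRr1// ltW.
    rewrite (_ : _ / N = c1 * (K%:R / N `^ gamma)); first by rewrite ler_wpM2l// ltW.
    by field; rewrite !lt0r_neq0.
  pose b := \sum_(k < K) (2 <= gamma)%R%:R * p k `^ (gamma - 2).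
  (* b <= B + V with V = K tau^(gamma-2), then (B+V)^2 <= 2 B^2 + 2 V^2, and V^2 / N^2 is exactly c2
     X. *)
  have bX : b ^+ 2 / N ^+ 2 <= 2 * ((2 <= gamma)%R%:R * (B ^+ 2 / N ^+ 2)) + 2 * (c2 * X).
    rewrite /b; have [g2|g2] := leP 2 gamma; last first.
      rewrite big1 => [|k _]; last by rewrite mul0r.
      rewrite expr0n/= !mul0r mulr0 add0r.
      by apply: mulr_ge0 => //; apply: mulr_ge0 => //; exact: ltW.
    under eq_bigr do rewrite mul1r.
    set s := \sum_(k < K) _; pose V := K%:R * tau `^ (gamma - 2).
    have sV : s <= B + V by apply: sum_powR_split_le => //; lra.
    have s0 : 0 <= s by apply: sumr_ge0 => k _; exact: powR_ge0.
    have V0 : 0 <= V by rewrite mulr_ge0 ?powR_ge0.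
    have VX : V ^+ 2 / N ^+ 2 = c2 * X.
      have N0' := ltW N0.
      rewrite /V /tau powR_div_sqrt// exprMn exprMn exprVn -!powR_mulrn ?powR_ge0//.
      rewrite -!powRrM (_ : (gamma - 2) * 2%:R = 2 * gamma - 4); last by ring.
      have -> : N `^ ((gamma - 2) / 2 * 2%:R) = N `^ gamma / N `^ 2%:R.
        rewrite (_ : (gamma - 2) / 2 * 2%:R = gamma - 2%:R); last by field.
        by rewrite powRB// (gt_eqF N0) implybT.
      rewrite -/c2 /X !powR_mulrn//.
      by field; rewrite !lt0r_neq0.
    rewrite mul1r -VX -mulrDr -mulrDl mulrA; apply: ler_wpM2r.
      by rewrite invr_ge0 exprn_ge0// ltW.
    have := sqr_ge0 (B - V).
    have : s ^+ 2 <= (B + V) ^+ 2 by rewrite lerXn2r ?nnegrE// addr_ge0.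
    rewrite !expr2; lra.
  apply: (le_trans (quadratic_risk_moment_bound _ _ _ _ model ps _ _ _ _ hgamma
    (ltW C00) taylor n0 alpha0 alpha1 A0 aA)).
  rewrite lee_fin -/N -/k1 -/k2 -/k3 -/X -/b -/B -/S.
  set Y := _ * (B ^+ 2 / N ^+ 2) in bX *; set Z := _ * (S / N) in AX *.
  have Y0 : 0 <= Y by rewrite mulr_ge0// divr_ge0 ?exprn_ge0// ltW.
  have Z0 : 0 <= Z by rewrite mulr_ge0// divr_ge0// ltW.
  have h1 := ler_wpM2l (ltW k10) AX.
  have h2 := ler_wpM2l (ltW k30) bX.
  (* The surplus in [C1] consists of products of nonnegative quantities; they are listed as
     hypotheses so that the conclusion becomes linear. *)
  have e (u v : R) : 0 < u -> 0 <= v -> 0 <= u * v by move=> u0 v0; rewrite mulr_ge0// ltW.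
  have := e _ _ k10 X0; have := e _ _ k10 Y0; have := e _ _ k10 Z0.
  have := e _ _ k20 Y0; have := e _ _ k20 Z0.
  have := e _ _ k30 X0; have := e _ _ k30 Y0; have := e _ _ k30 Z0.
  have := e _ _ (mulr_gt0 k10 c10) Y0; have := e _ _ (mulr_gt0 k10 c10) Z0.
  have := e _ _ (mulr_gt0 k30 c20) Y0; have := e _ _ (mulr_gt0 k30 c20) Z0.
  rewrite /C1; lra.
(* In the uniform bound, [hS] and [hB] cost 2 + 4 copies of the last term, and the first term enters
   once. *)
exists (7 * C1); split; first by rewrite mulr_gt0.
move=> K n alpha K0 n0 alpha0 alpha1 N1 d T x w N tau.
have N0 : 0 < N by apply: lt_le_trans N1.
have tau0 : 0 < tau by rewrite divr_gt0// sqrtr_gt0.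
have X0 : 0 <= K%:R ^+ 2 / N `^ gamma.
  by apply: divr_ge0; [exact: exprn_ge0|exact: powR_ge0].
split => [p P ps model|P model].
  apply: (le_trans (first_bound K n alpha K0 n0 alpha0 alpha1 N1 d T x w p P ps model)).
  rewrite lee_fin -/N -/tau; apply: ler_wpM2r; last by lra.
  by rewrite !addr_ge0// mulr_ge0// divr_ge0 ?exprn_ge0 ?power_sum_above_ge0// ltW.
apply: ge_ereal_sup => _ [p ps <-].
apply: (le_trans (first_bound K n alpha K0 n0 alpha0 alpha1 N1 d T x w p (P p) ps (model p ps))).
rewrite lee_fin -/N -/tau -[leRHS]mulrA [leRHS]mulrCA; apply: ler_wpM2l; first exact: ltW.
set X := _ / N `^ gamma in X0 *; set M := Num.min _ _; set W := Num.max _ _.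
have W1 : 1 <= W by rewrite le_max lexx orbT.
have WN0 : 0 <= W / N by rewrite divr_ge0 ?(ltW N0)//; lra.
have M0 : 0 < M by rewrite lt_min invr_gt0 tau0 ltr0n.
(* Here c >= 1 matters: 1/tau = sqrt(N)/c. *)
have MN : M <= Num.sqrt N.
  rewrite ge_min /tau invf_div ler_pdivrMr// ler_peMr// sqrtr_ge0//.
have s1 : 1 <= Num.sqrt N by have := ler_wsqrtr N1; rewrite sqrtr1.
have hS : (1 <= gamma)%R%:R * (power_sum_above tau (2 * gamma - 2) p / N)
    <= 2 * ((1 <= gamma)%R%:R * (W / N)).
  have [g1|_] := leP 1 gamma; last by rewrite !mul0r mulr0.
  rewrite !mul1r mulrA; apply: ler_wpM2r; first by rewrite invr_ge0 ltW.
  have [g2|g2] := leP 1 (2 * gamma - 2).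
    by have := @power_sum_above_le1 R K _ _ p ps tau0 g2; lra.
  have r0 : 0 <= 2 * gamma - 2 by lra.
  apply: (le_trans (@power_sum_above_le R K _ _ p ps tau0 K0 r0 (ltW g2))).
  rewrite ler_pM2l// le_max (_ : 1 - _ = 3 - 2 * gamma) ?lexx//; ring.
(* The middle term is absorbed by the last one: for gamma < 3, B <= 2 M^(3-gamma) <= 2 sqrt(N), and
   for gamma >= 3, B <= 1. Hence B^2 / N^2 <= 4 / N. *)
have hB : (2 <= gamma)%R%:R * (power_sum_above tau (gamma - 2) p ^+ 2 / N ^+ 2)
    <= 4 * ((1 <= gamma)%R%:R * (W / N)).
  have [g2|g2] := leP 2 gamma; last by rewrite mul0r; apply: mulr_ge0 => //; exact: mulr_ge0.
  have -> : (1 <= gamma) = true by apply/idP; lra.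
  rewrite !mul1r; set B := power_sum_above _ _ _.
  have B0 : 0 <= B by exact: power_sum_above_ge0.
  have Bs : B <= 2 * Num.sqrt N.
    have [g3|g3] := leP 1 (gamma - 2).
      by have := @power_sum_above_le1 R K _ _ p ps tau0 g3; rewrite -/B; lra.
    have r0 : 0 <= gamma - 2 by lra.
    apply: (le_trans (@power_sum_above_le R K _ _ p ps tau0 K0 r0 (ltW g3))).
    rewrite ler_pM2l// -/M; apply: (@le_trans _ _ (Num.sqrt N `^ (1 - (gamma - 2)))).
      by apply: ge0_ler_powR; rewrite ?nnegrE ?sqrtr_ge0 ?(ltW M0)//; lra.
    by apply: ler1_powR => //; lra.
  have BN : B ^+ 2 <= 4 * N.
    apply: (@le_trans _ _ ((2 * Num.sqrt N) ^+ 2)).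
      by rewrite lerXn2r ?nnegrE// mulr_ge0 ?sqrtr_ge0.
    by rewrite exprMn sqr_sqrtr ?(ltW N0)// -natrX.
  rewrite ler_pdivrMr ?exprn_gt0//; apply: (le_trans BN).
  rewrite (_ : 4 * (W / N) * N ^+ 2 = 4 * N * W); last by field; exact: lt0r_neq0.
  by rewrite ler_peMr// mulr_ge0// ltW.
set Y := _ * (_ / N ^+ 2) in hB *; set Z := _ * (_ / N) in hS *.
have : 0 <= (1 <= gamma)%R%:R * (W / N) by rewrite mulr_ge0.
lra.
Qed.
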